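(* Let $\kappa<\lambda$ be uncountable cardinals with $\lambda$ regular, and suppose there is a full $\square(\lambda,<\kappa)$-sequence. Then $\mathrm{Refl}(<\kappa,S)$ fails for every stationary $S\subseteq\lambda$.
   Context: For a set of ordinals $A$, $\mathrm{acc}(A)$ is the set of $\beta<\sup\{\alpha+1\mid\alpha\in A\}$ with $\beta=\sup(A\cap\beta)$. A coherent sequence of length $\lambda$ and width $<\eta$ is $\mathcal{C}=\langle\mathcal{C}_\alpha\mid\alpha<\lambda\rangle$ where each $\mathcal{C}_\alpha$ is a nonempty set of fewer than $\eta$ closed unbounded subsets of $\alpha$ (for successor $\alpha=\beta+1$, $\mathcal{C}_\alpha=\{\{\beta\}\}$), such that for all $\beta<\lambda$, $C\in\mathcal{C}_\beta$ and $\alpha\in\mathrm{acc}(C)$, $C\cap\alpha\in\mathcal{C}_\alpha$. A thread is a club $D\subseteq\lambda$ with $D\cap\alpha\in\mathcal{C}_\alpha$ for all $\alpha\in\mathrm{acc}(D)$. A $\square(\lambda,<\eta)$-sequence is a coherent sequence of length $\lambda$ and width $<\eta$ with no thread. For a coherent sequence $\mathcal{C}$, let $A_{\mathcal{C}}$ be the set of $\alpha<\lambda$ for which there is a club $D_\alpha\subseteq\lambda$ such that for every $\beta\in D_\alpha$, $\alpha\in\bigcup_{C\in\mathcal{C}_\beta}\mathrm{acc}(C)$; $\mathcal{C}$ is full if $A_{\mathcal{C}}$ is unbounded in $\lambda$. A stationary $S\subseteq\lambda$ reflects at $\alpha<\lambda$ if $\mathrm{cf}(\alpha)>\omega$ and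 $S\cap\alpha$ is stationary in $\alpha$; a collection of stationary sets reflects simultaneously if there is one $\alpha<\lambda$ at which all reflect. $\mathrm{Refl}(<\kappa,S)$ says every collection of fewer than $\kappa$ stationary subsets of $S$ reflects simultaneously. *)

(* Defs.v *)
(* Ordinals below lambda are modelled as the elements of a type L
   carrying a strict well-order lt (every well-order is isomorphic to an ordinal;
   lambda is then the order type of (L, lt)). kappa < lambda is an element k : L. *)
From Stdlib Require Import Classical.

Section OrdDefs.
Set Implicit Arguments.
Variable L : Type.
Variable lt : L -> L -> Prop.

Definition le (x y : L) : Prop := lt x y \/ x = y.

Definition is_wellorder : Prop :=
  (forall x, ~ lt x x) /\
  (forall x y z, lt x y -> lt y z -> lt x z) /\
  (forall x y, lt x y \/ x = y \/ lt y x) /\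
  well_founded lt.

Definition L_uncountable : Prop :=
  ~ exists f : L -> nat, forall x y, f x = f y -> x = y.

Definition L_regular : Prop :=
  forall (a : L) (f : L -> L), ~ (forall g, exists d, lt d a /\ le g (f d)).

Definition is_cardinal (k : L) : Prop :=
  forall b, lt b k -> ~ exists f : L -> L,
      (forall x, lt x k -> lt (f x) b) /\
      (forall x y, lt x k -> lt y k -> f x = f y -> x = y).

Definition ord_uncountable (k : L) : Prop :=
  ~ exists f : L -> nat, forall x y, lt x k -> lt y k -> f x = f y -> x = y.

(* a family of sets (sets counted up to extensional equality) has fewer than k
   members, k a cardinal: it injects into some ordinal g < k *)
Definition fewer_than (k : L) (F : (L -> Prop) -> Prop) : Prop :=
  exists g, lt g k /\ exists f : (L -> Prop) -> L,
    (forall E, F E -> lt (f E) g) /\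
    (forall E E', F E -> F E' -> f E = f E' -> forall x, E x <-> E' x).

Definition memS (F : (L -> Prop) -> Prop) (X : L -> Prop) : Prop :=
  exists E, F E /\ forall x, E x <-> X x.

(* acc(A) = { b < sup{a+1 | a in A} | b = sup(A cap b) } *)
Definition acc (A : L -> Prop) (b : L) : Prop :=
  (exists a, A a /\ le b a) /\
  (forall g, lt g b -> exists d, A d /\ lt g d /\ lt d b).

Definition is_succ_of (b a : L) : Prop :=
  lt a b /\ forall x, lt x b -> le x a.

Definition club_in (a : L) (C : L -> Prop) : Prop :=
  (forall x, C x -> lt x a) /\
  (forall g, lt g a -> exists d, C d /\ le g d) /\
  (forall g, lt g a -> (exists d, C d /\ lt d g) ->
     (forall h, lt h g -> exists d, C d /\ lt h d /\ lt d g) -> C g).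

Definition club (D : L -> Prop) : Prop :=
  (forall g, exists d, D d /\ le g d) /\
  (forall g, (exists d, D d /\ lt d g) ->
     (forall h, lt h g -> exists d, D d /\ lt h d /\ lt d g) -> D g).

Definition unc_cof (a : L) : Prop :=
  (exists d, lt d a) /\
  ~ exists f : nat -> L, (forall n, lt (f n) a) /\ (forall g, lt g a -> exists n, le g (f n)).

Definition stationary (S : L -> Prop) : Prop :=
  forall D, club D -> exists x, S x /\ D x.

Definition stationary_in (a : L) (S : L -> Prop) : Prop :=
  forall C, club_in a C -> exists x, S x /\ C x /\ lt x a.

Definition reflects_at (S : L -> Prop) (a : L) : Prop :=
  unc_cof a /\ stationary_in a S.

(* Refl(<k, S): every collection of fewer than k stationary subsets of S reflects
   simultaneously. A collection of fewer than k sets is given as an indexed family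
   (T d)_{d < g} with g < k. *)
Definition Refl (k : L) (S : L -> Prop) : Prop :=
  forall g, lt g k -> forall T : L -> (L -> Prop),
    (forall d, lt d g -> (forall x, T d x -> S x) /\ stationary (T d)) ->
    exists a, forall d, lt d g -> reflects_at (T d) a.

Definition coherent_seq (k : L) (Cs : L -> (L -> Prop) -> Prop) : Prop :=
  (forall a, exists C, Cs a C) /\
  (forall a C, Cs a C -> club_in a C) /\
  (forall a, fewer_than k (Cs a)) /\
  (forall a b, is_succ_of a b -> forall C, Cs a C <-> (forall x, C x <-> x = b)) /\
  (forall b C, Cs b C -> forall a, acc C a -> memS (Cs a) (fun x => C x /\ lt x a)).

Definition thread (Cs : L -> (L -> Prop) -> Prop) (D : L -> Prop) : Prop :=
  club D /\ forall a, acc D a -> memS (Cs a) (fun x => D x /\ lt x a).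

Definition square_seq (k : L) (Cs : L -> (L -> Prop) -> Prop) : Prop :=
  coherent_seq k Cs /\ ~ exists D, thread Cs D.

Definition A_set (Cs : L -> (L -> Prop) -> Prop) (a : L) : Prop :=
  exists D, club D /\ forall b, D b -> exists C, Cs b C /\ acc C a.

Definition full (Cs : L -> (L -> Prop) -> Prop) : Prop :=
  forall g, exists a, le g a /\ A_set Cs a.

End OrdDefs.

(* Main.v *)
From Stdlib Require Import Classical ClassicalEpsilon FunctionalExtensionality Lia.
Require Import Defs.

(** Suppose [Refl(<k, S)]. Fix [a] in [A_set Cs], with club [D]. If for every [E] in [Cs a] the set of
    [b] in [S] and [D] without a [C] in [Cs b] end-extending [E] were stationary, these fewer than [k]
    sets would reflect at a common [c]; then [c] is in [D], some [C] in [Cs c] has [a] in [acc C], and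
    coherence at a point of [acc C] lying in the set attached to [C ∩ a] is contradictory. So some
    [E a] in [Cs a] is end-extended by a member of [Cs b] for almost all [b] in [S].

    End-extension makes [A_set Cs] a tree. It has no antichain of size [k]: almost every [b] in [S]
    sees all of the [E a] involved below fewer than [k] members of [Cs b], and two nodes below the same
    [C] are comparable. Since [k < λ] and [λ] is regular, such a tree has a node above which it is an
    unbounded chain, and the union of the [E a] along that chain is a thread. *)

(** * Well-orders: least elements, recursion with choice, suprema of sequences *)

Section WellOrder.
Context (L : Type) (lt : L -> L -> Prop) (hwo : is_wellorder lt).

Local Notation "x ≺ y" := (lt x y) (at level 70).
Local Notation "x ≼ y" := (le lt x y) (at level 70).

Lemma lt_irrefl x : ~ x ≺ x.
Proof. apply hwo. Qed.

Lemma lt_trans x y z : x ≺ y -> y ≺ z -> x ≺ z.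
Proof. apply hwo. Qed.

Lemma lt_total x y : x ≺ y \/ x = y \/ y ≺ x.
Proof. apply hwo. Qed.

Lemma lt_wf : well_founded lt.
Proof. apply hwo. Qed.

Lemma le_lt_trans x y z : x ≼ y -> y ≺ z -> x ≺ z.
Proof. intros [H | ->]; eauto using lt_trans. Qed.

Lemma lt_le_trans x y z : x ≺ y -> y ≼ z -> x ≺ z.
Proof. intros H [H' | <-]; eauto using lt_trans. Qed.

Lemma lt_asym x y : x ≺ y -> ~ y ≺ x.
Proof. intros H H'. exact (lt_irrefl _ (lt_trans _ _ _ H H')). Qed.

Lemma not_le_lt x y : ~ x ≼ y -> y ≺ x.
Proof.
  intros H. destruct (lt_total x y) as [H' | [H' | H']]; trivial; exfalso; apply H; [left | right]; trivial.
Qed.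

Lemma not_lt_le x y : ~ x ≺ y -> y ≼ x.
Proof.
  intros H. destruct (lt_total x y) as [H' | [H' | H']]; [easy | right | left]; auto.
Qed.

Lemma upper_bound2 x y : exists z, x ≼ z /\ y ≼ z.
Proof.
  destruct (lt_total x y) as [H | [H | H]].
  - exists y. split; [left | right]; trivial.
  - exists y. split; right; trivial.
  - exists x. split; [right | left]; trivial.
Qed.

Lemma upper_bound2_below x y c : x ≺ c -> y ≺ c -> exists z, z ≺ c /\ x ≼ z /\ y ≼ z.
Proof.
  intros Hx Hy. destruct (lt_total x y) as [H | [<- | H]].
  - exists y. split; [trivial | split; [left | right]; trivial].
  - exists x. split; [trivial | split; right; trivial].
  - exists x. split; [trivial | split; [right | left]; trivial].
Qed.

Lemma least_element (P : L -> Prop) :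
  (exists x, P x) -> exists x, P x /\ forall y, y ≺ x -> ~ P y.
Proof.
  intros [x Hx]. induction (lt_wf x) as [x _ IH].
  destruct (classic (exists y, y ≺ x /\ P y)) as [(y & Hy & Py) | H].
  - exact (IH y Hy Py).
  - exists x. split; [trivial | intros y Hy Py; apply H; eauto].
Qed.

(** The recursion only knows the values below [i], padded with [b0] elsewhere; the first hypothesis
    says that [P i] does not see the padding. All the greedy constructions below go through this
    lemma. *)
Lemma wf_dependent_choice (B : Type) (b0 : B) (P : L -> (L -> B) -> B -> Prop) :
  (forall i f f' x, (forall j, j ≺ i -> f j = f' j) -> P i f x -> P i f' x) ->
  (forall i f, exists x, P i f x) ->
  exists f, forall i, P i f (f i).
Proof.
  intros Hext Hex.
  pose (extend := fun i (rec : forall j, j ≺ i -> B) j =>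
          match excluded_middle_informative (j ≺ i) with
          | left h => rec j h
          | right _ => b0
          end).
  pose (F := fun i (rec : forall j, j ≺ i -> B) => epsilon (inhabits b0) (P i (extend i rec))).
  exists (Fix lt_wf (fun _ => B) F). intros i.
  rewrite Fix_eq.
  - unfold F at 2. eapply Hext; [ | apply epsilon_spec, Hex ].
    intros j Hj. unfold extend.
    destruct (excluded_middle_informative (j ≺ i)); easy.
  - intros x f g Hfg. f_equal.
    apply functional_extensionality_dep; intros y.
    apply functional_extensionality_dep; intros p. apply Hfg.
Qed.

Lemma increasing_sup (x : nat -> L) (b : L) :
  (forall n, x n ≺ x (S n)) -> (forall n, x n ≺ b) ->
  exists s, s ≼ b /\ (forall n, x n ≺ s) /\ (forall h, h ≺ s -> exists n, h ≺ x n).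
Proof.
  intros Hinc Hb.
  destruct (least_element (fun s => forall n, x n ≺ s)) as (s & Hs & Hmin); [eauto|].
  exists s. repeat split; trivial.
  - apply not_lt_le. intros Hbs. exact (Hmin b Hbs Hb).
  - intros h Hh. destruct (not_all_ex_not _ _ (Hmin h Hh)) as [n Hn].
    exists (S n). eapply le_lt_trans; [apply not_lt_le; exact Hn | apply Hinc].
Qed.

(** * Clubs in a point of uncountable cofinality *)

Lemma unc_cof_limit a g : unc_cof lt a -> g ≺ a -> exists h, g ≺ h /\ h ≺ a.
Proof.
  intros [_ Hunc] Hg. apply NNPP. intros Hno. apply Hunc.
  (* With nothing strictly between [g] and [a], the constant sequence [g] is cofinal in [a]. *)
  exists (fun _ => g). split; [trivial|].
  intros h Hh. exists O. apply not_lt_le. intros H. apply Hno. eauto.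
Qed.

Lemma club_in_unbounded_strict a C g :
  unc_cof lt a -> club_in lt a C -> g ≺ a -> exists d, C d /\ g ≺ d /\ d ≺ a.
Proof.
  intros Ha (Hsub & Hunb & _) Hg.
  destruct (unc_cof_limit a g Ha Hg) as (h & Hgh & Hha).
  destruct (Hunb h Hha) as (d & Hd & Hhd).
  exists d. split; [trivial|]. split; [eapply lt_le_trans; eauto | auto].
Qed.

(** An increasing sequence of points of [C] is not cofinal in [a], so its supremum is below [a] and
    is an accumulation point of [C]. Starting the sequence past [g] and [h] gives unboundedness of
    the tail. *)
Lemma acc_tail_club_in a C g :
  unc_cof lt a -> club_in lt a C -> g ≺ a ->
  club_in lt a (fun x => acc lt C x /\ g ≺ x /\ x ≺ a).
Proof.
  intros Ha HC Hg. split; [easy|]. split.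
  - intros h Hh.
    assert (Hstep : forall x, exists d, x ≺ a -> C d /\ x ≺ d /\ d ≺ a).
    { intros x. destruct (classic (x ≺ a)) as [Hx | Hx].
      - destruct (club_in_unbounded_strict a C x Ha HC Hx) as [d Hd]. exists d. auto.
      - exists a. easy. }
    destruct (choice _ Hstep) as [next Hnext]. clear Hstep.
    destruct (upper_bound2_below g h a Hg Hh) as (m & Hma & Hgm & Hhm).
    pose (x := fix x n := match n with O => next m | S n => next (x n) end).
    assert (Hx : forall n, C (x n) /\ m ≺ x n /\ x n ≺ a).
    { induction n as [|n (IH1 & IH2 & IH3)]; simpl; [auto|].
      destruct (Hnext (x n) IH3) as (H1 & H2 & H3). eauto using lt_trans. }
    assert (Hb : exists b, b ≺ a /\ forall n, x n ≺ b).
    { apply NNPP. intros Hno. apply (proj2 Ha). exists x. split; [apply Hx|].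
      intros b Hb. apply NNPP. intros Hbn. apply Hno. exists b. split; [trivial|].
      intros n. apply not_le_lt. eauto. }
    destruct Hb as (b & Hba & Hb).
    destruct (increasing_sup x b) as (s & Hsb & Hxs & Hsup); [| trivial |].
    { intros n. simpl. apply Hnext, Hx. }
    assert (Hms : m ≺ s) by (apply lt_trans with (x O); [apply Hx | apply Hxs]).
    assert (Hsa : s ≺ a) by (eapply le_lt_trans; eauto).
    exists s. split; [|left; eapply le_lt_trans; eauto].
    split; [split | split]; [| | eapply le_lt_trans; eauto | trivial].
    + destruct (proj1 (proj2 HC) s Hsa) as (d & Hd & Hsd). eauto.
    + intros e He. destruct (Hsup e He) as [n Hn].
      exists (x n). split; [apply Hx | auto].
  - intros e Hea (d & (Hd & Hgd & _) & Hde) Hlim.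
    split; [split | split]; [| | eauto using lt_trans | trivial].
    + destruct (proj1 (proj2 HC) e Hea) as (c & Hc & Hec). eauto.
    + intros f Hf. destruct (Hlim f Hf) as (c & ((_ & Hc) & _) & Hfc & Hce).
      destruct (Hc f Hfc) as (c' & Hc' & Hfc' & Hcc'). eauto using lt_trans.
Qed.

(** * Clubs in the regular cardinal *)

Section Regular.
Context (hreg : L_regular lt).

Lemma regular_bound a (f : L -> L) : exists b, forall d, d ≺ a -> f d ≺ b.
Proof.
  destruct (not_all_ex_not _ _ (hreg a f)) as [b Hb].
  exists b. intros d Hd. apply not_le_lt. eauto.
Qed.

Context (k : L) (hkunc : ord_uncountable lt k).

(** There is no last point: a constant function on the nonempty [k] is bounded strictly. *)
Lemma regular_unbounded2 x y : exists z, x ≺ z /\ y ≺ z.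
Proof.
  assert (Hk : exists d, d ≺ k).
  { apply NNPP. intros Hno. apply hkunc. exists (fun _ => O).
    intros u v Hu. exfalso. eauto. }
  destruct Hk as [d Hd], (upper_bound2 x y) as (m & Hxm & Hym).
  destruct (regular_bound k (fun _ => m)) as [b Hb].
  exists b. split; eapply le_lt_trans; eauto.
Qed.

(* [phi] counts up along [k] and restarts at [0] once it has become unbounded; it must become
   unbounded, since otherwise it would be injective below [k]. *)
Lemma unbounded_nat_function : exists phi : L -> nat, forall m, exists d, d ≺ k /\ m <= phi d.
Proof.
  destruct (wf_dependent_choice nat O (fun d phi n =>
    (forall j, j ≺ d -> phi j < n) \/ ~ exists m, forall j, j ≺ d -> phi j < m)) as [phi Hphi].
  - intros i f f' x Hff [H | H]; [left | right].
    + intros j Hj. rewrite <- Hff; auto.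
    + intros [m Hm]. apply H. exists m. intros j Hj. rewrite Hff; auto.
  - intros i f. destruct (classic (exists m, forall j, j ≺ i -> f j < m)) as [[m Hm] | H].
    + exists m. auto.
    + exists O. auto.
  - exists phi. apply NNPP. intros Hno.
    destruct (not_all_ex_not _ _ Hno) as [m Hm].
    assert (Hbd : forall d, d ≺ k -> phi d < m).
    { intros d Hd. destruct (PeanoNat.Nat.lt_ge_cases (phi d) m); [trivial|]. exfalso. eauto. }
    assert (Hinc : forall d j, d ≺ k -> j ≺ d -> phi j < phi d).
    { intros d j Hd Hj. destruct (Hphi d) as [H | H]; [auto|].
      exfalso. apply H. exists m. intros i Hi. apply Hbd. eauto using lt_trans. }
    apply hkunc. exists phi. intros x y Hx Hy Hxy.
    destruct (lt_total x y) as [H | [H | H]]; [| trivial |].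
    + pose proof (Hinc y x Hy H). lia.
    + pose proof (Hinc x y Hx H). lia.
Qed.

(** [regular_bound] speaks of families indexed by an initial segment of [L], so the sequence is
    reindexed along [k] through an unbounded [phi]; monotonicity carries the bound to every term. *)
Lemma increasing_bounded (x : nat -> L) :
  (forall n, x n ≺ x (S n)) -> exists b, forall n, x n ≺ b.
Proof.
  intros Hinc. destruct unbounded_nat_function as [phi Hphi].
  destruct (regular_bound k (fun d => x (phi d))) as [b Hb].
  exists b. intros n. destruct (Hphi n) as (d & Hd & Hn).
  apply le_lt_trans with (x (phi d)); [| auto].
  clear Hd. induction Hn as [|m _ IH]; [right; trivial | left; eapply le_lt_trans; eauto].
Qed.

Lemma club_unbounded_strict D g : club lt D -> exists d, D d /\ g ≺ d.
Proof.
  intros [Hunb _]. destruct (regular_unbounded2 g g) as (h & Hgh & _).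
  destruct (Hunb h) as (d & Hd & Hhd). exists d. split; [trivial | eapply lt_le_trans; eauto].
Qed.

(** Between [x] and [next x] there is a point of every [Q i], so the supremum of the iterates of
    [next] is a limit of all the [Q i] at once. *)
Lemma club_bigcap a (Q : L -> L -> Prop) :
  (forall i, i ≺ a -> club lt (Q i)) -> club lt (fun x => forall i, i ≺ a -> Q i x).
Proof.
  intros HQ. split.
  - intros g.
    assert (Hstep : forall x, exists y, x ≺ y /\
              forall i, i ≺ a -> exists q, Q i q /\ x ≺ q /\ q ≺ y).
    { intros x.
      assert (Hpick : forall i, exists q, i ≺ a -> Q i q /\ x ≺ q).
      { intros i. destruct (classic (i ≺ a)) as [Hi | Hi].
        - destruct (club_unbounded_strict (Q i) x (HQ i Hi)) as [q Hq]. eauto.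
        - exists x. easy. }
      destruct (choice _ Hpick) as [q Hq].
      destruct (regular_bound a q) as [b Hb].
      destruct (regular_unbounded2 x b) as (y & Hxy & Hby).
      exists y. split; [trivial|]. intros i Hi.
      exists (q i). destruct (Hq i Hi). eauto using lt_trans. }
    destruct (choice _ Hstep) as [next Hnext].
    pose (x := fix x n := match n with O => g | S n => next (x n) end).
    assert (Hinc : forall n, x n ≺ x (S n)) by (intros n; simpl; apply Hnext).
    destruct (increasing_bounded x Hinc) as [b Hb].
    destruct (increasing_sup x b Hinc Hb) as (s & _ & Hxs & Hsup).
    exists s. split; [| left; exact (Hxs O)].
    intros i Hi. apply (proj2 (HQ i Hi)).
    + destruct (proj2 (Hnext (x O)) i Hi) as (q & Hq & _ & Hqy).
      exists q. split; [trivial | exact (lt_trans _ _ _ Hqy (Hxs 1))].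
    + intros h Hh. destruct (Hsup h Hh) as [n Hn].
      destruct (proj2 (Hnext (x n)) i Hi) as (q & Hq & Hxq & Hqy).
      exists q. split; [trivial|]. split; [eauto using lt_trans|].
      exact (lt_trans _ _ _ Hqy (Hxs (S n))).
  - intros g (d & Hd & Hdg) Hlim i Hi. apply (proj2 (HQ i Hi)).
    + eauto.
    + intros h Hh. destruct (Hlim h Hh) as (e & He & Hhe). eauto.
Qed.

Lemma club_cap D D' : club lt D -> club lt D' -> club lt (fun x => D x /\ D' x).
Proof.
  intros HD HD'.
  destruct (regular_unbounded2 k k) as (y & Hky & _).
  destruct (regular_unbounded2 k y) as (a & Hka & Hya).
  (* [D] sits at the index [k] and [D'] everywhere else; [y] is a second index below [a], so that
     both sets occur. *)
  pose (Q := fun i => if excluded_middle_informative (i = k) then D else D').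
  assert (HQ : forall x, (D x /\ D' x) <-> forall i, i ≺ a -> Q i x).
  { intros x. unfold Q. split.
    - intros [Hx Hx'] i _. destruct (excluded_middle_informative (i = k)); trivial.
    - intros H. pose proof (H k Hka) as Hk. pose proof (H y Hya) as Hy.
      destruct (excluded_middle_informative (k = k)); [| easy].
      destruct (excluded_middle_informative (y = k)) as [-> |]; [| easy].
      destruct (lt_irrefl k Hky). }
  destruct (club_bigcap a Q) as [Hunb Hcl].
  { intros i _. unfold Q. destruct (excluded_middle_informative (i = k)); trivial. }
  split.
  - intros g. destruct (Hunb g) as (d & Hd & Hgd). exists d. split; [apply HQ|]; trivial.
  - intros g (d & Hd & Hdg) Hlim. apply HQ, Hcl.
    + exists d. split; [apply HQ|]; trivial.
    + intros h Hh. destruct (Hlim h Hh) as (e & He & Hhe). exists e. split; [apply HQ|]; trivial.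
Qed.

(** * Trees on a regular cardinal without large antichains *)

Section Tree.
Context (R : L -> L -> Prop) (A : L -> Prop).
Context (R_lt : forall x y, R x y -> x ≺ y).
Context (R_trans : forall x y z, R x y -> R y z -> R x z).
Context (R_tree : forall x y z, R x z -> R y z -> x ≺ y -> R x y).
Context (R_A : forall x y, R x y -> A y).
(** An antichain of size [k] is given by an increasing enumeration; as [R] refines the order, only
    relations going forward have to be denied. *)
Context (no_antichain : ~ exists f : L -> L,
  (forall i, i ≺ k -> A (f i)) /\
  (forall i j, j ≺ k -> i ≺ j -> f i ≺ f j /\ ~ R (f i) (f j))).

Definition unbounded (P : L -> Prop) : Prop := forall g, exists x, P x /\ g ≺ x.

Lemma not_unbounded P : ~ unbounded P -> exists b, forall x, P x -> x ≼ b.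
Proof.
  intros H. destruct (not_all_ex_not _ _ H) as [b Hb].
  exists b. intros x Hx. apply not_lt_le. eauto.
Qed.

(** From an unbounded [P] one could choose greedily, each node beyond the earlier ones and their
    bounds, and obtain an antichain of length [k]. Used for the nodes of one rank and for the nodes
    with a bounded cone. *)
Lemma eventually_unrelated_bounded (P : L -> Prop) :
  (forall x, P x -> A x) ->
  (forall x, P x -> exists b, forall y, P y -> b ≺ y -> ~ R x y) ->
  ~ unbounded P.
Proof.
  intros PA Hb Hunb.
  assert (Hb' : forall x, exists b, P x -> forall y, P y -> b ≺ y -> ~ R x y).
  { intros x. destruct (classic (P x)) as [Hx | Hx].
    - destruct (Hb x Hx) as [b H]. eauto.
    - exists x. easy. }
  destruct (choice _ Hb') as [b Hbx].
  destruct (wf_dependent_choice L k (fun i f x =>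
    P x /\ forall j, j ≺ i -> f j ≺ x /\ b (f j) ≺ x)) as [f Hf].
  - intros i f f' x Hff [Hx H]. split; [trivial|].
    intros j Hj. rewrite <- Hff; auto.
  - intros i f.
    destruct (regular_bound i f) as [b1 Hb1].
    destruct (regular_bound i (fun j => b (f j))) as [b2 Hb2].
    destruct (upper_bound2 b1 b2) as (m & H1 & H2).
    destruct (Hunb m) as (x & Hx & Hmx).
    exists x. split; [trivial|].
    intros j Hj. split; apply lt_trans with m; trivial; eapply lt_le_trans; eauto.
  - apply no_antichain. exists f. split.
    + intros i _. apply PA, Hf.
    + intros i j _ Hij. destruct (proj2 (Hf j) i Hij) as [H1 H2].
      split; [trivial|]. apply Hbx; trivial; apply Hf.
Qed.

Section Splitting.
Context (N : L -> Prop) (N_A : forall x, N x -> A x) (N_unb : unbounded N).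
Context (s : L -> L).
Context (s_split : forall w, N w -> exists x y,
  R w x /\ R w y /\ x ≺ y /\ ~ R x y /\ y ≺ s w).

(* Greedy choice: a node is kept unless some kept node [v] below it splits only beyond it, at [s v]. *)
Lemma sparse_nodes : exists G : L -> Prop,
  unbounded G /\ (forall w, G w -> N w) /\
  (forall v w, G v -> G w -> R v w -> s v ≼ w).
Proof.
  destruct (wf_dependent_choice Prop True (fun w G p =>
    p <-> N w /\ forall v, R v w -> G v -> s v ≼ w)) as [G HG].
  - intros i f f' x Hff ->. split; intros [Hi H]; (split; [trivial|]); intros v Hv; specialize (H v Hv);
      rewrite (Hff v (R_lt _ _ Hv)) in *; trivial.
  - intros i f. eexists. reflexivity.
  - exists G. split; [| split].
    + apply NNPP. intros Hno. destruct (not_unbounded G Hno) as [b Hb].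
      (* If [b] bounds [G], then some [c] bounds [s] on all of [G], and every node of [N] past [b]
         and [c] passes the test for being kept. *)
      destruct (regular_unbounded2 b b) as (b' & Hbb' & _).
      destruct (regular_bound b' s) as [c Hc].
      destruct (regular_unbounded2 b c) as (m & Hbm & Hcm).
      destruct (N_unb m) as (z & Hz & Hmz).
      assert (HnG : ~ G z).
      { intros Hz'. apply (lt_irrefl z). eapply le_lt_trans; [exact (Hb z Hz') |].
        eauto using lt_trans. }
      apply HnG, HG. split; [trivial|]. intros v Hv Gv.
      left. apply lt_trans with c; [| eauto using lt_trans].
      apply Hc. eapply le_lt_trans; eauto.
    + intros w Hw. apply (proj1 (HG w) Hw).
    + intros v w Hv Hw Hvw. apply (proj1 (HG w) Hw); trivial.
Qed.

(** [h] is the rank of a node over the nodes of [G] below it. The second clause says that these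
    ranks have no gaps, so a node of rank at least [k] has nodes of [G] of every rank under [k]
    below it. *)
Lemma rank_exists (G : L -> Prop) : exists h : L -> L,
  (forall v w, G v -> R v w -> h v ≺ h w) /\
  (forall w i, i ≺ h w -> exists v, G v /\ R v w /\ h v = i).
Proof.
  destruct (wf_dependent_choice L k (fun w h p =>
    (forall v, G v -> R v w -> h v ≺ p) /\
    (forall q, q ≺ p -> ~ forall v, G v -> R v w -> h v ≺ q))) as [h Hh].
  - intros i f f' x Hff [H1 H2]. split.
    + intros v Gv Hv. rewrite <- Hff; auto.
    + intros q Hq H. apply (H2 q Hq). intros v Gv Hv. rewrite Hff; auto.
  - intros i f. apply least_element.
    destruct (regular_bound i f) as [b Hb]. exists b. auto.
  - exists h. split.
    + intros v w. apply (Hh w).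
    + intros w. induction (lt_wf w) as [w _ IH]. intros i Hi.
      (* [i] is less than the least strict bound, so some [v] below [w] has rank at least [i]; if
         the rank is larger, induction descends further. *)
      destruct (not_all_ex_not _ _ (proj2 (Hh w) i Hi)) as [v Hv].
      apply imply_to_and in Hv as [Gv Hv]. apply imply_to_and in Hv as [Rv Hv].
      destruct (not_lt_le _ _ Hv) as [Hlt | ->]; [| eauto].
      destruct (IH v (R_lt _ _ Rv) i Hlt) as (u & Gu & Ru & Hu). eauto.
Qed.

(* A node of rank at least [k] exists because the nodes of a given rank form an antichain. The
   nodes splitting off the branch below it then form an antichain of size [k]. *)
Lemma splitting_antichain : False.
Proof.
  destruct sparse_nodes as (G & Gunb & GN & Gs).
  destruct (rank_exists G) as (h & Hinc & Hsurj).
  assert (Hlev : forall i, exists b, forall z, G z -> h z = i -> z ≼ b).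
  { intros i. destruct (not_unbounded (fun z => G z /\ h z = i)) as [b Hb]; [| eauto].
    apply eventually_unrelated_bounded.
    - intros x [Hx _]. auto.
    - intros x [Hx Hi]. exists x. intros y [Hy Hi'] _ HR.
      apply (lt_irrefl i). rewrite <- Hi at 1. rewrite <- Hi'. auto. }
  destruct (choice _ Hlev) as [b Hb].
  destruct (regular_bound k b) as [c Hc].
  destruct (Gunb c) as (z & Gz & Hcz).
  assert (Hkz : k ≼ h z).
  { apply not_lt_le. intros Hzk. apply (lt_irrefl z).
    eapply le_lt_trans; [apply (Hb (h z)); trivial|]. eauto using lt_trans. }
  assert (Hw : forall i, exists w, i ≺ k -> G w /\ R w z /\ h w = i).
  { intros i. destruct (classic (i ≺ k)) as [Hi | Hi].
    - destruct (Hsurj z i) as [w Hw]; [eapply lt_le_trans; eauto | eauto].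
    - exists z. easy. }
  destruct (choice _ Hw) as [w Hwi]. clear Hw.
  (* Two nodes below [z] are comparable, so one node of the incomparable pair over [w i] is not
     below [z]. *)
  assert (Hu : forall i, exists u, i ≺ k -> R (w i) u /\ ~ R u z /\ u ≺ s (w i)).
  { intros i. destruct (classic (i ≺ k)) as [Hi | Hi]; [| exists z; easy].
    destruct (Hwi i Hi) as (Gw & Rw & _).
    destruct (s_split (w i) (GN _ Gw)) as (x & y & Hx & Hy & Hxy & HnR & Hys).
    destruct (classic (R x z)) as [Rx | Rx].
    - exists y. intros _. split; [trivial|]. split; [| trivial].
      intros Ry. apply HnR. eauto.
    - exists x. eauto using lt_trans. }
  destruct (choice _ Hu) as [u Hui]. clear Hu.
  apply no_antichain. exists u. split.
  - intros i Hi. eapply R_A, (Hui i Hi).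
  - intros i j Hj Hij.
    assert (Hi : i ≺ k) by eauto using lt_trans.
    destruct (Hwi i Hi) as (Gi & Ri & hi), (Hwi j Hj) as (Gj & Rj & hj).
    destruct (Hui i Hi) as (Rui & Nui & sui), (Hui j Hj) as (Ruj & Nuj & suj).
    (* Both nodes are below [z], hence comparable, and their ranks decide the direction. *)
    assert (Rij : R (w i) (w j)).
    { destruct (lt_total (w i) (w j)) as [H | [H | H]].
      - eauto.
      - exfalso. apply (lt_irrefl i). rewrite <- hi, H, hj in Hij at 1. congruence.
      - exfalso. apply (lt_asym i j Hij). rewrite <- hi, <- hj. eauto. }
    (* Sparsity puts [s (w i)], and so [u i], before [w j]. If [u i] were below [u j], it would be
       below [w j] and therefore below [z]. *)
    assert (Hlt : u i ≺ w j) by (eapply lt_le_trans; eauto).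
    split; [eauto using lt_trans|].
    intros HR. apply Nui. apply R_trans with (w j); eauto.
Qed.

End Splitting.

(** The nodes with a bounded cone are bounded by some [n]. If no cone past [n] were a chain, some
    [s] would bound an incomparable pair over each node past [n], and [splitting_antichain] would
    apply. *)
Lemma tree_unbounded_branch : unbounded A ->
  exists a, A a /\ unbounded (R a) /\
    forall x y, R a x -> R a y -> x ≺ y -> R x y.
Proof.
  intros Aunb.
  destruct (not_unbounded (fun a => A a /\ ~ unbounded (R a))) as [n Hn].
  { apply eventually_unrelated_bounded; [easy|].
    intros x [_ Hx]. destruct (not_unbounded _ Hx) as [b Hb].
    exists b. intros y _ Hby Hxy. apply (lt_irrefl y). eapply le_lt_trans; eauto. }
  assert (Hcone : forall a, A a -> n ≺ a -> unbounded (R a)).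
  { intros a Ha Hna. apply NNPP. intros H. apply (lt_irrefl n).
    eapply lt_le_trans; eauto. }
  apply NNPP. intros Hno.
  assert (Hs : forall w, exists t, A w /\ n ≺ w -> exists x y,
             R w x /\ R w y /\ x ≺ y /\ ~ R x y /\ y ≺ t).
  { intros w. destruct (classic (A w /\ n ≺ w)) as [[Aw Hw] | H]; [| exists w; easy].
    apply NNPP. intros Hnt. apply Hno. exists w. split; [trivial|]. split; [auto|].
    intros x y Hx Hy Hxy. apply NNPP. intros HR. apply Hnt.
    destruct (regular_unbounded2 y y) as (t & Ht & _). exists t. intros _.
    exists x, y. auto. }
  destruct (choice _ Hs) as [s Hs'].
  apply (splitting_antichain (fun a => A a /\ n ≺ a)) with (s := s); [easy | | trivial].
  intros g. destruct (upper_bound2 n g) as (m & H1 & H2).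
  destruct (Aunb m) as (x & Hx & Hmx). exists x.
  split; [split; [trivial|] |]; eapply le_lt_trans; eauto.
Qed.

End Tree.

(** * Coherent sequences *)

Section Coherent.
Context (Cs : L -> (L -> Prop) -> Prop) (hcoh : coherent_seq lt k Cs).

(** The accumulation clause ties this relation to coherence, which puts the part below such an [a]
    of any member of [Cs b] into [Cs a]. *)
Definition end_extends (C : L -> Prop) (a : L) (E : L -> Prop) : Prop :=
  acc lt C a /\ forall x, E x <-> C x /\ x ≺ a.

(** Accumulation is local: as [b] is a limit of [C], a point of [C] between [a] and [b] witnesses it
    already in [F]. This makes two nodes under one [C] comparable. *)
Lemma end_extends_cut C a E b F :
  end_extends C a E -> end_extends C b F -> a ≺ b -> end_extends F a E.
Proof.
  intros [[_ Ha] HE] [[_ Hb] HF] Hab. split; [split|].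
  - destruct (Hb a Hab) as (d & Hd & Had & Hdb). exists d. split; [apply HF; auto | left; trivial].
  - intros g Hg. destruct (Ha g Hg) as (d & Hd & Hgd & Hda).
    exists d. split; [apply HF; eauto using lt_trans | auto].
  - intros x. rewrite HE, HF. split; intros H; repeat split; try apply H.
    apply lt_trans with a; [apply H | trivial].
Qed.

Lemma end_extends_trans C b F a E :
  end_extends C b F -> end_extends F a E -> a ≺ b -> end_extends C a E.
Proof.
  intros [_ HF] [[(c & Hc & Hac) Ha] HE] Hab. split; [split|].
  - exists c. split; [apply HF | ]; trivial.
  - intros g Hg. destruct (Ha g Hg) as (d & Hd & Hgd & Hda).
    exists d. split; [apply HF | auto]; trivial.
  - intros x. rewrite HE, HF. split; intros H; repeat split; try apply H.
    apply lt_trans with a; [apply H | trivial].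
Qed.

Lemma stationary_mono (S T : L -> Prop) :
  (forall x, S x -> T x) -> stationary lt S -> stationary lt T.
Proof. intros HST HS D HD. destruct (HS D HD) as (x & Hx & HDx). eauto. Qed.

Lemma almost_everywhere_extended S a :
  stationary lt S -> Refl lt k S -> A_set lt Cs a ->
  exists E Q, Cs a E /\ club lt Q /\
    forall b, S b -> Q b -> exists C, Cs b C /\ end_extends C a E.
Proof.
  destruct hcoh as (_ & Hclub & Hwidth & _ & Hcoh).
  intros HS HRefl (D & HD & HDacc).
  assert (HE : exists E, Cs a E /\
    ~ stationary lt (fun b => S b /\ D b /\ ~ exists C, Cs b C /\ end_extends C a E)).
  { apply NNPP. intros Hno.
    destruct (Hwidth a) as (g & Hg & f & Hfg & Hinj).
    (* The set for [E] is indexed by the code [f E]; an index that is not a code imposes nothing,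
       and its set is all of [S]. *)
    pose (T := fun d b => S b /\ forall E, Cs a E -> f E = d ->
                 D b /\ ~ exists C, Cs b C /\ end_extends C a E).
    destruct (HRefl g Hg T) as [c Hc].
    { intros d _. split; [intros x Hx; apply Hx|].
      destruct (classic (exists E, Cs a E /\ f E = d)) as [(E & HE & <-) | H].
      - apply stationary_mono with
          (fun b => S b /\ D b /\ ~ exists C, Cs b C /\ end_extends C a E).
        + intros b (HSb & HDb & HnC). split; [trivial|]. intros E' HE' Hf.
          split; [trivial|]. intros (C & HC & Hacc & Hext). apply HnC.
          exists C. split; [trivial|]. split; [trivial|].
          intros x. rewrite <- Hext. symmetry. apply Hinj; auto.
        + apply NNPP. intros Hns. apply Hno. eauto.
      - apply stationary_mono with S; [| trivial].
        intros x Hx. split; [trivial|]. intros E HE Hf. exfalso. eauto. }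
    destruct (proj1 hcoh a) as [E0 HE0].
    (* The set attached to [E0] lies in [D] and meets every tail of [c], since tails are club in
       [c]; so [c] is a limit of [D]. *)
    assert (HDc : D c).
    { destruct (Hc _ (Hfg E0 HE0)) as [Hunc Hst].
      assert (Hlim : forall h, h ≺ c -> exists d, D d /\ h ≺ d /\ d ≺ c).
      { intros h Hh. destruct (Hst (fun x => h ≺ x /\ x ≺ c)) as (x & (_ & Hx) & Hhx & Hxc).
        - split; [easy|]. split.
          + intros g' Hg'. destruct (upper_bound2_below h g' c Hh Hg') as (m & Hmc & Hhm & Hgm).
            destruct (unc_cof_limit c m Hunc Hmc) as (x & Hmx & Hxc).
            exists x. split; [split; [eapply le_lt_trans|]; eauto|].
            left. eapply le_lt_trans; eauto.
          + intros g' Hg' (d & (Hd & _) & Hdg) _. eauto using lt_trans.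
        - exists x. split; [apply (Hx E0 HE0); trivial | easy]. }
      apply (proj2 HD); [| trivial].
      destruct Hunc as [[h Hh] _]. destruct (Hlim h Hh) as (d & Hd & _ & Hdc). eauto. }
    destruct (HDacc c HDc) as (C & HC & Hacc).
    destruct (Hcoh c C HC a Hacc) as (E & HE & HEx).
    assert (Hac : a ≺ c).
    { destruct Hacc as [(e & He & Hae) _]. apply le_lt_trans with e; trivial.
      apply (Hclub c C HC); trivial. }
    (* The set attached to [E] has a point [b] in the accumulation points of [C] past [a]. By
       coherence [C] cut at [b] is a member of [Cs b], and it end-extends [E], which membership of
       [b] forbids. *)
    destruct (Hc _ (Hfg E HE)) as [Hunc Hst].
    destruct (Hst _ (acc_tail_club_in c C a Hunc (Hclub c C HC) Hac))
      as (b & (_ & HTb) & (Haccb & Hab & Hbc) & _).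
    destruct (HTb E HE eq_refl) as [_ HnC]. apply HnC.
    destruct (Hcoh c C HC b Haccb) as (F & HF & HFx).
    exists F. split; [trivial|].
    apply end_extends_cut with C b; [| | trivial]; split; trivial. }
  destruct HE as (E & HE & Hns).
  destruct (not_all_ex_not _ _ Hns) as [Q HQ]. apply imply_to_and in HQ as [HQ Hdisj].
  (* The failures were collected inside [D] only, so [Q] is cut down to [D]. *)
  exists E, (fun x => D x /\ Q x). split; [trivial|]. split; [apply club_cap; trivial|].
  intros b HSb [HDb HQb]. apply NNPP. intros HnC. apply Hdisj. eauto.
Qed.

(** Below each [x] in [X] the union agrees with [E x]. Closure and coherence at a point are local,
    so they are inherited from [E x] for an [x] beyond that point. *)
Lemma thread_of_chain (E : L -> L -> Prop) (X : L -> Prop) :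
  (forall x, X x -> Cs x (E x)) -> unbounded X ->
  (forall x y, X x -> X y -> x ≺ y -> end_extends (E y) x (E x)) ->
  thread lt Cs (fun d => exists x, X x /\ E x d).
Proof.
  destruct hcoh as (_ & Hclub & _ & _ & Hcoh).
  intros HE HX Hext. set (D := fun d => exists x, X x /\ E x d).
  assert (HD : forall x d, X x -> d ≺ x -> (D d <-> E x d)).
  { intros x d Hx Hd. split; [intros (y & Hy & Hyd) | intros H; exists x; auto].
    destruct (lt_total x y) as [H | [<- | H]]; trivial.
    - apply (Hext x y Hx Hy H). auto.
    - apply (Hext y x Hy Hx H). auto. }
  split; [split|].
  - intros g. destruct (HX g) as (x & Hx & Hgx).
    destruct (proj1 (proj2 (Hclub x _ (HE x Hx))) g Hgx) as (d & Hd & Hgd).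
    exists d. split; [exists x; auto | trivial].
  - intros g (d & Hd & Hdg) Hlim. destruct (HX g) as (x & Hx & Hgx).
    apply (HD x g Hx Hgx). apply (Hclub x _ (HE x Hx)); trivial.
    + exists d. split; [apply (HD x); eauto using lt_trans | trivial].
    + intros h Hh. destruct (Hlim h Hh) as (e & He & Hhe & Heg).
      exists e. split; [apply (HD x); eauto using lt_trans | auto].
  - intros a [_ Ha]. destruct (HX a) as (x & Hx & Hax).
    destruct (Hcoh x (E x) (HE x Hx) a) as (F & HF & HFx).
    + split.
      * destruct (proj1 (proj2 (Hclub x _ (HE x Hx))) a Hax) as (d & Hd & Had). eauto.
      * intros g Hg. destruct (Ha g Hg) as (d & Hd & Hgd & Hda).
        exists d. split; [apply (HD x); eauto using lt_trans | auto].
    + exists F. split; [trivial|]. intros y. rewrite HFx.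
      split; intros [H1 H2]; (split; [| trivial]); apply (HD x); eauto using lt_trans.
Qed.

Lemma thread_of_almost_everywhere_extended S A (E Q : L -> L -> Prop) :
  is_cardinal lt k -> stationary lt S -> unbounded A ->
  (forall a, A a -> Cs a (E a) /\ club lt (Q a) /\
    forall b, S b -> Q a b -> exists C, Cs b C /\ end_extends C a (E a)) ->
  exists D, thread lt Cs D.
Proof.
  intros hkcard HS HA HEQ.
  pose (R := fun a b => A a /\ A b /\ a ≺ b /\ end_extends (E b) a (E a)).
  destruct (tree_unbounded_branch R A) as (a & Aa & Hunb & Hchain); trivial.
  - unfold R. easy.
  - intros x y z (Ax & Ay & Hxy & H1) (_ & Az & Hyz & H2).
    refine (conj Ax (conj Az (conj _ _))); [| eapply end_extends_trans]; eauto using lt_trans.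
  - intros x y z (Ax & Az & Hxz & H1) (Ay & _ & Hyz & H2) Hxy.
    refine (conj Ax (conj Ay (conj Hxy _))). eapply end_extends_cut; eauto.
  - unfold R. easy.
  - intros (f & HfA & Hf).
    (* The [k] clubs of an antichain share a point [b] of [S], so every node of the antichain is
       under some member of [Cs b]. *)
    destruct (HS _ (club_bigcap k (fun i => Q (f i)) (fun i Hi => proj1 (proj2 (HEQ _ (HfA i Hi))))))
      as (b & HSb & HQb).
    assert (HC : forall i, exists C, i ≺ k -> Cs b C /\ end_extends C (f i) (E (f i))).
    { intros i. destruct (classic (i ≺ k)) as [Hi | Hi]; [| exists (E i); easy].
      destruct (proj2 (proj2 (HEQ _ (HfA i Hi))) b HSb (HQb i Hi)) as [C HC]. eauto. }
    destruct (choice _ HC) as [C HCi].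
    destruct (proj1 (proj2 (proj2 hcoh)) b) as (g & Hg & phi & Hphi & Hinj).
    (* One [C] over two nodes would make them comparable. Hence the codes of the chosen members of
       [Cs b] are distinct, and the cardinal [k] would inject into [g]. *)
    assert (Hne : forall i j, j ≺ k -> i ≺ j -> phi (C i) = phi (C j) -> False).
    { intros i j Hj Hij Heq. assert (Hi : i ≺ k) by eauto using lt_trans.
      destruct (Hf i j Hj Hij) as [Hlt HnR]. apply HnR.
      destruct (HCi i Hi) as [Ci [[(c & Hc & Hfc) Hacc] HEi]], (HCi j Hj) as [Cj Hextj].
      pose proof (Hinj _ _ Ci Cj Heq) as Hsame.
      split; [auto|]. split; [auto|]. split; [trivial|].
      apply end_extends_cut with (C j) (f j); trivial.
      split; [split|].
      - exists c. split; [apply Hsame|]; trivial.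
      - intros h Hh. destruct (Hacc h Hh) as (d & Hd & Hhd).
        exists d. split; [apply Hsame|]; trivial.
      - intros x. rewrite HEi, Hsame. reflexivity. }
    apply (hkcard g Hg). exists (fun i => phi (C i)). split.
    + intros i Hi. apply Hphi, HCi, Hi.
    + intros x y Hx Hy Heq. destruct (lt_total x y) as [H | [H | H]]; [| trivial |]; exfalso; eauto.
  - exists (fun d => exists x, R a x /\ E x d). apply thread_of_chain; trivial.
    + intros x (_ & Ax & _). apply HEQ, Ax.
    + intros x y Hx Hy Hxy. apply (Hchain x y Hx Hy Hxy).
Qed.

End Coherent.

End Regular.
End WellOrder.

Theorem theorem2p11 (L : Type) (lt : L -> L -> Prop)
  (hwo : is_wellorder lt)
  (hLunc : L_uncountable L) (hLreg : L_regular lt)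
  (k : L) (hkcard : is_cardinal lt k) (hkunc : ord_uncountable lt k)
  (Cs : L -> (L -> Prop) -> Prop)
  (hsq : square_seq lt k Cs) (hfull : full lt Cs) :
  forall S : L -> Prop, stationary lt S -> ~ Refl lt k S.
Proof.
  intros S HS HRefl. destruct hsq as [hcoh Hnothread]. apply Hnothread.
  assert (HEQ : forall a, exists p : (L -> Prop) * (L -> Prop), A_set lt Cs a ->
    Cs a (fst p) /\ club lt (snd p) /\
    forall b, S b -> snd p b -> exists C, Cs b C /\ end_extends L lt C a (fst p)).
  { intros a. destruct (classic (A_set lt Cs a)) as [Ha | Ha].
    - destruct (almost_everywhere_extended L lt hwo hLreg k hkunc Cs hcoh S a HS HRefl Ha)
        as (E & Q & H). exists (E, Q). auto.
    - exists (S, S). easy. }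
  destruct (choice _ HEQ) as [p Hp].
  apply (thread_of_almost_everywhere_extended L lt hwo hLreg k hkunc Cs hcoh S (A_set lt Cs)
    (fun a => fst (p a)) (fun a => snd (p a))); trivial.
  (* Fullness gives a non-strict bound, so it is applied at some [h] past [g]. *)
  intros g. destruct (regular_unbounded2 L lt hwo hLreg k hkunc g g) as (h & Hgh & _).
  destruct (hfull h) as (a & Hha & Ha).
  exists a. split; [trivial | eapply lt_le_trans; eauto].
Qed.
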